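(* Assume $\neg\mathsf{CH}$. If $X=\bigoplus_{n\in\omega}X_n$ is the topological sum of countably many compact zero-dimensional spaces $X_n$ that are not basically disconnected, then the remainder $X^*=\beta X\setminus X$ is not Cohen-Parovičenko.
   Context: Compact spaces are Hausdorff. A space is \emph{basically disconnected} if each cozero-set has clopen closure. $\mathfrak{c}=2^{\aleph_0}$. A subalgebra $A$ of a Boolean algebra $B$ is \emph{$\aleph_0$-ideal} if for each $b\in B\setminus A$ the ideal $\{a\in A: a<b\}$ of $A$ has a countable cofinal subset. For an uncountable cardinal $\kappa$, $B$ is \emph{$(\kappa,\aleph_0)$-ideal} if there is a family $\mathcal{A}$ of $\aleph_0$-ideal subalgebras of $B$ of cardinality $\kappa$ such that every subset of $B$ of size $\kappa$ is contained in a member of $\mathcal{A}$ and $\mathcal{A}$ is closed under unions of chains of length at most $\kappa$ and of uncountable cofinality. $B$ is \emph{$( *,\aleph_0)$-ideal} if it is $(\kappa,\aleph_0)$-ideal for every regular uncountable $\kappa<|B|$. For subsets $S,T$ of a Boolean algebra, $S\perp T$ means $s\wedge t=0$ for all $s\in S$, $t\in T$. A subset $A$ of $B$ is \emph{$\aleph_0$-ideal complete} if for any two countable (possibly finite or empty) subsets $S,T$ of $A$ with $S\perp T$, and such that $1$ is not the join of a finite subset of $S\cup T$, there is $b\in B\setminus A$ such that $s\le b$ for all $s\in S$, $t\wedge b=0$ for all $t\in T$, every $a\in A$ with $a\le b$ lies below a finite join of elements of $S$, and every $a\in A$ with $a\wedge b=0$ lies below a finite join of elements of $T$. $\mathfrak{m}_c(B)$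 is the minimum cardinality of a subset of $B$ that is not $\aleph_0$-ideal complete. A Boolean algebra $B$ is \emph{Cohen-Parovičenko} if it is $( *,\aleph_0)$-ideal and $\mathfrak{m}_c(B)=\mathfrak{c}$. A zero-dimensional space is \emph{Cohen-Parovičenko} if its algebra of clopen sets is. *)

(* Defs.v *)
From HB Require Import structures.
From mathcomp Require Import all_boot all_order all_algebra.
From mathcomp Require Import all_classical all_reals.
From mathcomp Require Import wochoice topology normedtype.

Set Implicit Arguments.
Unset Strict Implicit.
Unset Printing Implicit Defensive.

Import Order.TTheory GRing.Theory Num.Theory.
Import numFieldNormedType.Exports.

Local Open Scope classical_set_scope.
Local Open Scope card_scope.

Definition card_lt (T U : Type) (A : set T) (B : set U) : Prop :=
  A #<= B /\ ~ (B #<= A).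

(* The cardinal of the continuum is represented by [[set: set nat]]. *)
Definition CH : Prop :=
  forall A : set (set nat), countable A \/ A #= [set: set nat].

Section ordinals.
Variables (K : Type) (le : rel K).
Implicit Types (C D : set K).

(* A type [K] well-ordered by [le] stands for its order type.  It is a cardinal
   (initial ordinal) when all its proper initial segments are smaller. *)
Definition is_cardinal : Prop :=
  well_order le /\
  forall i, card_lt [set j | le j i /\ j <> i] [set: K].

Definition initial_segment D : Prop :=
  forall i j, D i -> le j i -> D j.

Definition cofinal_in C D : Prop :=
  C `<=` D /\ forall i, D i -> exists2 j, C j & le i j.

Definition uncountable_cofinality D : Prop :=
  forall C, cofinal_in C D -> ~ countable C.

Definition regular_uncountable_cardinal : Prop :=
  [/\ is_cardinal, ~ countable [set: K] &
      forall C, cofinal_in C [set: K] -> C #= [set: K]].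

End ordinals.

Section boolean_algebras.
Local Open Scope order_scope.
Context {d : Order.disp_t} {B : ctbDistrLatticeType d}.
Implicit Types (A S T C : set B) (F : set (set B)).

Definition subalgebra A : Prop :=
  [/\ A \bot, A \top,
      forall a b, A a -> A b -> A (Order.meet a b),
      forall a b, A a -> A b -> A (Order.join a b) &
      forall a, A a -> A (Order.compl a)].

Definition aleph0_ideal A : Prop :=
  subalgebra A /\
  forall b, ~ A b -> exists C,
    [/\ countable C,
        forall c, C c -> A c /\ c < b &
        forall a, A a -> a < b -> exists2 c, C c & a <= c].

(* Since [K] is an initial ordinal, its initial segments are the ordinals of
   length at most [K], so they index the chains of length at most [K]. *)
Definition closed_under_chains (K : Type) (le : rel K) F : Prop :=
  forall (D : set K) (A : K -> set B),
    initial_segment le D -> uncountable_cofinality le D ->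
    (forall i, D i -> F (A i)) ->
    (forall i j, D i -> D j -> le i j -> A i `<=` A j) ->
    F (\bigcup_(i in D) A i).

Definition kappa_aleph0_ideal (K : Type) (le : rel K) : Prop :=
  exists F,
    [/\ forall A, F A -> aleph0_ideal A /\ A #= [set: K],
        forall S, S #= [set: K] -> exists2 A, F A & S `<=` A &
        closed_under_chains le F].

Definition finite_join_of S (x : B) : Prop :=
  exists2 s : seq B, (forall y, y \in s -> S y) & x = \join_(y <- s) y.

Definition orthogonal S T : Prop :=
  forall s t, S s -> T t -> Order.meet s t = \bot.

Definition aleph0_ideal_complete A : Prop :=
  forall S T, S `<=` A -> T `<=` A -> countable S -> countable T ->
    orthogonal S T -> ~ finite_join_of (S `|` T)%classic \top ->
    exists b, [/\ ~ A b,
      forall s, S s -> s <= b,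
      forall t, T t -> Order.meet t b = \bot,
      forall a, A a -> a <= b ->
        exists2 x, finite_join_of S x & a <= x &
      forall a, A a -> Order.meet a b = \bot ->
        exists2 x, finite_join_of T x & a <= x].

End boolean_algebras.

Section cohen_parovicenko.
Context {d : Order.disp_t} (B : ctbDistrLatticeType d).

Definition star_aleph0_ideal : Prop :=
  forall (K : Type) (le : rel K), regular_uncountable_cardinal le ->
    card_lt [set: K] [set: B] -> kappa_aleph0_ideal (B := B) le.

(* The minimum defining m_c exists and is the cardinality of [K]. *)
Definition mc_is (K : Type) : Prop :=
  (exists2 A : set B, ~ aleph0_ideal_complete A & A #= [set: K]) /\
  (forall A : set B, ~ aleph0_ideal_complete A -> [set: K] #<= A).

Definition cohen_parovicenko : Prop :=
  star_aleph0_ideal /\ mc_is (set nat).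

End cohen_parovicenko.

Record clopens (T : topologicalType) := Clopens {
  clopen_val :> set T;
  clopen_valP : clopen_val \in [pred A : set T | `[< clopen A >]] }.

Section clopens_algebra.
Local Open Scope order_scope.
Variable T : topologicalType.
Local Notation P := [pred A : set T | `[< clopen A >]].

HB.instance Definition _ := [isSub of clopens T for @clopen_val T].
HB.instance Definition _ := [Choice of clopens T by <:].

Let clopen_meet : meet_closed P.
Proof.
by move=> A B /asboolP cA /asboolP cB; apply/asboolP; exact: clopenI.
Qed.

Let clopen_join : join_closed P.
Proof.
by move=> A B /asboolP cA /asboolP cB; apply/asboolP; exact: clopenU.
Qed.

Let clopen_bot : (\bot : set T) \in P.
Proof. by apply/asboolP; exact: clopen0. Qed.

Let clopen_top : (\top : set T) \in P.
Proof. by apply/asboolP; exact: clopenT. Qed.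

HB.instance Definition _ :=
  Order.SubChoice_isTBSubLattice.Build set_display (set T) P set_display
    (clopens T) clopen_meet clopen_join clopen_bot clopen_top.

Let clopens_meetUl :
  @left_distributive (clopens T) (clopens T) Order.meet Order.join.
Proof. by move=> A B C; apply: val_inj; exact: setIUl. Qed.

HB.instance Definition _ :=
  Order.Lattice_Meet_isDistrLattice.Build set_display (clopens T)
    clopens_meetUl.

Let clopenC_subproof (A : clopens T) : (~` (A : set T))%classic \in P.
Proof.
by case: A => A /= /asboolP cA; apply/asboolP; exact: clopenC.
Qed.

Let clopens_compl (A : clopens T) : clopens T := Clopens (clopenC_subproof A).

Let clopens_joinxC A : Order.join A (clopens_compl A) = \top.
Proof. by apply: val_inj; exact: setUv. Qed.

Let clopens_meetxC A : Order.meet A (clopens_compl A) = \bot.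
Proof. by apply: val_inj; exact: setICr. Qed.

HB.instance Definition _ :=
  Order.TBDistrLattice_hasComplement.Build set_display (clopens T)
    clopens_joinxC clopens_meetxC.

End clopens_algebra.

(* Meant for zero-dimensional [T]. *)
Definition cohen_parovicenko_space (T : topologicalType) : Prop :=
  cohen_parovicenko (clopens T).

Definition cozero_set (R : realType) (T : topologicalType) (A : set T) : Prop :=
  exists2 f : T -> R, continuous f & A = [set x | f x != 0%R].

Definition basically_disconnected (R : realType) (T : topologicalType) : Prop :=
  forall A : set T, cozero_set R A -> clopen (closure A).

(* The Stone-Cech compactification is determined up to homeomorphism by its
   universal property. *)
Record is_stone_cech (X bX : topologicalType) (e : X -> bX) : Prop := {
  stone_cech_hausdorff : hausdorff_space bX;
  stone_cech_compact : compact [set: bX];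
  stone_cech_injective : injective e;
  stone_cech_continuous : continuous e;
  stone_cech_embedding :
    forall U : set X, open U -> exists2 V : set bX, open V & U = e @^-1` V;
  stone_cech_dense : dense (range e);
  stone_cech_extension :
    forall (Y : topologicalType) (f : X -> Y),
      hausdorff_space Y -> compact [set: Y] -> continuous f ->
      exists2 g : bX -> Y, continuous g & forall x, g (e x) = f x }.

(* Points of the compactification outside the image of [e], with the subspace
   topology. *)
Definition remainder (X bX : topologicalType) (e : X -> bX) : topologicalType :=
  set_type (~` range e).

(* Main.v *)
Require Import Defs.
From mathcomp Require Import all_boot all_order all_algebra.
From mathcomp Require Import all_classical all_reals.
From mathcomp Require Import wochoice topology normedtype.

(** Write [B_n] for the clopen algebra of [X_n] and [B] for that of the
    remainder.  Extending clopen subsets of the sum to its Stone-Cech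
    compactification identifies [B] with the reduced product of the [B_n]
    modulo finite sets ([trace_surj], [trace_meet], [trace_compl],
    [trace_bot]).  As [X_n] is not basically disconnected, there are clopen
    sets [c n k], [k] in [nat], whose union has a closure that is not open; in
    terms of [B_n], no member of the annihilator of the sequence [c n] is
    maximal ([not_basically_disconnected_gap]).

    Let [polar] be the ideal of those elements of [B] with a representative
    [x] such that every [x n] is disjoint from every [c n k].  The two halves
    of the Cohen-Parovicenko property give contradictory information on the
    traces of [polar] on subalgebras of size [aleph_1].

    - Since CH fails, [aleph_1 < m_c(B)].  Completeness applied to countably
      many disjoint infinite subsets of [nat] shows that no family of [aleph_1]
      functions is dominating ([not_dominating_of_complete]).  Hence, for [A] of
      size at most [aleph_1], some [f] is such that the element [u] with
      coordinates [u n], the join of the [c n k] for [k <= f n], meets every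
      member of [A] outside [polar], while it is disjoint from the members of
      [polar].  So the members of [A] in [polar] are exactly those below the
      complement of [u] ([polar_separation]), and if [A] is an [aleph_0]-ideal
      subalgebra then countably many of them are cofinal
      ([polar_countably_cofinal]).

    - A diagonal argument shows that no countable subset of [polar] is cofinal
      in it ([polar_gap]).  As the family of subalgebras is closed under unions
      of chains of length [omega_1], a member [A] of it can be reached by
      adding at each stage an element of [polar] that lies below no element of
      [polar] present so far.  A countable subset of [A] appears at some stage,
      so it cannot be cofinal in the trace of [polar] on [A]
      ([reduced_product_not_cohen_parovicenko]).

    The ordinal [omega_1] is realised by a well-ordered type that is
    uncountable with countable initial segments; the failure of CH makes it
    strictly smaller than the continuum. *)

Set Implicit Arguments.
Unset Strict Implicit.
Unset Printing Implicit Defensive.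

Import Order.Theory GRing.Theory Num.Theory numFieldNormedType.Exports.

Local Open Scope classical_set_scope.
Local Open Scope card_scope.

(** * The first uncountable ordinal *)

Lemma card_leT_inj (T U : Type) (A : set U) : [set: T] #<= A ->
  exists2 f : T -> U, (forall x, A (f x)) & injective f.
Proof.
move=> /card_leP[f]; exists (fun x => val (f (to_setT x))).
  by move=> x; have := valP (f (to_setT x)); rewrite inE.
move=> x y /val_inj /inj => /(_ (in_setT _) (in_setT _)).
by move=> /(congr1 val).
Qed.

Lemma infinite_set_inj (T : Type) (A : set T) :
  infinite_set A -> exists2 f : nat -> T, (forall n, A (f n)) & injective f.
Proof. by move=> /infiniteP /card_leT_inj. Qed.

Lemma injective_card_le_range (T U : Type) (f : T -> U) : injective f ->
  [set: T] #<= range f.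
Proof.
move=> finj; have : range f #= [set: T] by apply: inj_card_eq => x y _ _ /finj.
by rewrite card_eq_le => /andP[].
Qed.

(** Such an order has order type [omega_1]. *)
Definition omega1_order (K : Type) (le : rel K) : Prop :=
  [/\ well_order le, forall i, countable [set j | le j i] &
      ~ countable [set: K]].

Section well_order.
Variables (K : eqType) (le : rel K).
Hypothesis le_wo : well_order le.

Let lt (j i : K) : Prop := le j i /\ j <> i.

Let le_chain : wo_chain le {: K}.
Proof. exact: withinW. Qed.

Lemma well_order_refl i : le i i.
Proof. exact: (wo_chain_reflexive le_chain). Qed.

Lemma well_order_total i j : le i j || le j i.
Proof. exact: (wo_chainW le_chain). Qed.

Lemma well_order_anti i j : le i j -> le j i -> i = j.
Proof.
by move=> ij ji; apply: (wo_chain_antisymmetric le_chain) => //; apply/andP.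
Qed.

Lemma well_order_lt_wf : well_founded lt.
Proof.
apply: contrapT; rewrite /well_founded => /existsNP[i0 Ni0].
have [|i [[+ imin] _]] := le_wo (A := [pred i | `[< ~ Acc lt i >]]).
  by exists i0; apply/asboolP.
move=> /asboolP; apply; constructor=> j [ji jNi]; apply: contrapT => Nj.
by apply: jNi; apply: well_order_anti => //; apply: imin; apply/asboolP.
Qed.

End well_order.

Section omega1.
Variables (K : eqType) (le : rel K).
Hypothesis le_omega1 : omega1_order le.

Let le_wo : well_order le.
Proof. by case: le_omega1. Qed.

Let segment_countable i : countable [set j | le j i].
Proof. by case: le_omega1. Qed.

Let K_uncountable : ~ countable [set: K].
Proof. by case: le_omega1. Qed.

Let lt (j i : K) : Prop := le j i /\ j <> i.

(** Countably many countable segments cannot exhaust [K]. *)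
Lemma omega1_countable_bounded (C : set K) : countable C ->
  exists i, forall j, C j -> lt j i.
Proof.
move=> cC; apply: contrapT => /forallNP noi; apply: K_uncountable.
apply: (@sub_countable _ _ _ (\bigcup_(j in C) [set i | le i j])); last first.
  by apply: bigcup_countable => // i _; exact: segment_countable.
apply: subset_card_le => i _; have /existsNP[j /not_implyP[Cj Nji]] := noi i.
exists j => //=; have [->|/eqP jNi] := eqVneq j i.
  exact: (well_order_refl le_wo).
by have /orP[//|ji] := well_order_total le_wo i j; exfalso; apply: Nji.
Qed.

(** By recursion on [i], the values [f i n] can be chosen outside the countable
    set of values already used, because [C] is uncountable.  This one recursion
    gives both the minimality of [aleph_1] among uncountable cardinals and
    [aleph_1 * aleph_0 = aleph_1]. *)
Lemma omega1_rectangle_inj (T : Type) (C : set T) : ~ countable C ->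
  exists f : K -> nat -> T, (forall i n, C (f i n)) /\
    forall i j m n, f i m = f j n -> i = j /\ m = n.
Proof.
move=> Cunc.
have /choice[g gP] : forall W : set T, exists f : nat -> T, countable W ->
    (forall n, C (f n) /\ ~ W (f n)) /\ injective f.
  move=> W; have [cW|NW] := pselect (countable W); last first.
    have [] : exists f : nat -> T, True.
      have /infinite_set_inj[f _ _] : infinite_set C.
        by move=> /finite_set_countable.
      by exists f.
    by move=> f _; exists f.
  have /infinite_set_inj[f fC finj] : infinite_set (C `\` W).
    move=> /finite_set_countable cCW; apply: Cunc.
    apply: (@sub_countable _ _ _ (\bigcup_(b in [set: bool])
      if b then C `\` W else W)); last by apply: bigcup_countable => // -[].
    apply: subset_card_le => x Cx; have [Wx|NWx] := pselect (W x).
      by exists false.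
    by exists true.
  by exists f => _; split => // n; have [] := fC n.
pose f := Fix (well_order_lt_wf le_wo) (fun _ => nat -> T)
  (fun i rec => g [set x | exists j (h : lt j i) n, x = rec j h n]).
have fE i : f i = g [set x | exists j (h : lt j i) n, x = f j n].
  rewrite /f Fix_eq // => k F1 F2 F12; congr g; apply/seteqP; split => x /=.
    by move=> [j [h [n ->]]]; exists j, h, n; rewrite F12.
  by move=> [j [h [n ->]]]; exists j, h, n; rewrite F12.
have cW i : countable [set x | exists j (h : lt j i) n, x = f j n].
  apply: (@sub_countable _ _ _ (\bigcup_(j in [set j | le j i]) range (f j))).
    by apply: subset_card_le => x [j [h [n ->]]]; exists j; [case: h|exists n].
  apply: bigcup_countable => // j _.
  exact: sub_countable (card_image_le _ _) (countableP _).
have flt i j m n : lt j i -> f i m <> f j n.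
  move=> ji; have [fP _] := gP _ (cW i); have [_ +] := fP m.
  by rewrite -fE => + fE2; apply; exists j, ji, n.
exists f; split=> [i n|i j m n fij].
  by have [fP _] := gP _ (cW i); have [+ _] := fP n; rewrite -fE.
have ij : i = j.
  have [//|/eqP ij] := eqVneq i j.
  have /orP[le_ij|le_ji] := well_order_total le_wo i j.
    by case: (flt j i n m).
  by case: (@flt i j m n) => //; split=> // /esym.
split=> //; subst j; have [_ ginj] := gP _ (cW i); apply: ginj.
by rewrite -fE.
Qed.

Lemma omega1_card_le (T : Type) (C : set T) : ~ countable C -> [set: K] #<= C.
Proof.
move=> /omega1_rectangle_inj[f [fC finj]].
apply: card_le_trans (injective_card_le_range (f := f^~ 0%N) _) _.
  by move=> i j /finj[].
by apply: subset_card_le => _ [i _ <-].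
Qed.

Lemma omega1_regular : regular_uncountable_cardinal le.
Proof.
have cofunc (C : set K) : cofinal_in le C [set: K] -> ~ countable C.
  move=> [_ Ccof] /omega1_countable_bounded[i iP].
  have [j Cj ij] := Ccof i I; have [ji jNi] := iP _ Cj.
  by apply: jNi; exact: (well_order_anti le_wo).
split => //.
  split=> // i; have cseg : countable [set j | le j i /\ j <> i].
    apply: sub_countable (segment_countable i).
    by apply: subset_card_le => j [].
  split; first exact: card_leT.
  by move=> /sub_countable/(_ cseg).
move=> C /cofunc/omega1_card_le KC; apply/card_eqPle; split=> //.
exact: card_leT.
Qed.

Lemma omega1_uncountable_cofinality : uncountable_cofinality le [set: K].
Proof.
move=> C [_ Ccof] /omega1_countable_bounded[i iP].
have [j Cj ij] := Ccof i I; have [ji jNi] := iP _ Cj.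
by apply: jNi; exact: (well_order_anti le_wo).
Qed.

Lemma card_le_omega1P (T : Type) (A : set T) :
  A #<= [set: K] <-> exists f : T -> K, {in A &, injective f}.
Proof.
split=> [/card_leP[f]|[f finj]].
  have [i0 _] := omega1_countable_bounded (countable0 K).
  exists (fun x => if pselect (A x) is left Ax
    then val (f (exist _ x (mem_set Ax))) else i0) => x y; rewrite !inE => Ax Ay.
  case: pselect => // Ax'; case: pselect => // Ay' /val_inj.
  by move=> /inj => /(_ (in_setT _) (in_setT _)) /(congr1 val).
have : f @` A #= A by exact: inj_card_eq.
rewrite card_eq_le => /andP[_]; move=> /card_le_trans; apply; exact: card_leT.
Qed.

Lemma card_le_omega1_countable (T : Type) (A : set T) :
  countable A -> A #<= [set: K].
Proof.
have [f [_ finj]] := omega1_rectangle_inj K_uncountable.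
have [i0 _] := omega1_countable_bounded (countable0 K).
move=> /countable_injP[c cinj]; apply/card_le_omega1P; exists (f i0 \o c).
by move=> x y Ax Ay /= /finj[_]; exact: cinj.
Qed.

Lemma card_le_omega1_bigcup (I T : Type) (D : set I) (A : I -> set T) :
  countable D -> (forall i, D i -> A i #<= [set: K]) ->
  \bigcup_(i in D) A i #<= [set: K].
Proof.
move=> /countable_injP[c cinj] AK.
have [f [_ finj]] := omega1_rectangle_inj K_uncountable.
have [i0 _] := omega1_countable_bounded (countable0 K).
have /choice[g gP] : forall i, exists g : T -> K,
    D i -> {in A i &, injective g}.
  move=> i; have [/AK/card_le_omega1P[g ginj]|NDi] := pselect (D i).
    by exists g.
  by exists (fun=> i0).
have /choice[d dP] : forall x, exists p : K * nat, forall i, D i -> A i x ->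
    exists2 j, D j /\ A j x & p = (g j x, c j).
  move=> x; have [[j [Dj Ajx]]|NA] := pselect (exists j, D j /\ A j x).
    by exists (g j x, c j) => i _ _; exists j.
  by exists (i0, 0%N) => i Di Aix; case: NA; exists i.
apply/card_le_omega1P; exists (fun x => f (d x).1 (d x).2) => x y.
rewrite !inE => -[i Di Aix] [j Dj Ajy].
have [i' [Di' Ai'x] ->] := dP x i Di Aix.
have [j' [Dj' Aj'y] ->] := dP y j Dj Ajy.
move=> /= /finj[/[swap] /cinj]; rewrite !inE => /(_ Di' Dj') ij; subst j'.
by apply: gP; rewrite ?inE.
Qed.

End omega1.

(** Among the points of a well-order of [T], those with countably many
    predecessors form an initial segment.  It is uncountable: otherwise the
    first point outside it would also have countably many predecessors. *)
Lemma exists_omega1 (T : choiceType) : ~ countable [set: T] ->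
  exists (K : choiceType) (le : rel K), omega1_order le.
Proof.
move=> Tunc; have [R Rwo] := well_ordering_principle T.
pose D := [set i | countable [set j | R j i]].
exists (D : Type), (fun i j => R (val i) (val j)).
have val_countable (A : set T) (B : set D) :
    countable A -> (forall x, B x -> A (val x)) -> countable B.
  move=> cA BA; apply: (@sub_countable _ _ _ (val @` B)).
    have : val @` B #= B by apply: inj_card_eq => x y _ _ /val_inj.
    by rewrite card_eq_le => /andP[].
  by apply: sub_countable cA; apply: subset_card_le => _ [x /BA Ax <-].
split=> [A [i Ai]|i|cD].
- have [|z [[/asboolP[z' Az' <-{z}] zmin] zuniq]] :=
    Rwo [pred x | `[< exists2 j, j \in A & val j = x >]].
    by exists (val i); apply/asboolP; exists i.
  exists z'; split=> [|y [Ay ymin]].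
    by split=> // j Aj; apply: zmin; apply/asboolP; exists j.
  apply: val_inj; apply: zuniq; split; first by apply/asboolP; exists y.
  by move=> x /asboolP[j /ymin + <-].
- apply: (val_countable [set j | R j (val i)]) => //.
  by have := valP i; rewrite inE.
have {}cD : countable D.
  apply: sub_countable cD; apply: card_le_trans (card_image_le val _).
  by apply: subset_card_le => x Dx; exists (exist _ x (mem_set Dx)).
have [|u [[/asboolP NDu umin] _]] := Rwo [pred i | `[< ~ D i >]].
  apply: contrapT => noi; apply: Tunc; apply: sub_countable cD.
  apply: subset_card_le => i _; apply: contrapT => NDi; apply: noi; exists i.
  exact/asboolP.
apply: NDu; apply: (@sub_countable _ _ _ (\bigcup_(b in [set: bool])
  if b then D else [set u])); last first.
  by apply: bigcup_countable => // -[] _ //; exact: countable1.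
apply: subset_card_le => j /= ju; have [Dj|NDj] := pselect (D j).
  by exists true.
exists false => //=; apply: (well_order_anti Rwo) => //.
by apply: umin; apply/asboolP.
Qed.

(** * Reduced products and non-dominating families *)

Lemma injective_nat_preimage_bounded (g : nat -> nat) N : injective g ->
  exists M, forall j, (g j < N)%N -> (j < M)%N.
Proof.
move=> ginj; elim: N => [|N [M MP]]; first by exists 0%N.
have [[j0 gj0]|Nj0] := pselect (exists j, g j = N).
  exists (maxn M j0.+1) => j; rewrite ltnS leq_eqVlt leq_max.
  by move=> /orP[/eqP gj|/MP->//]; rewrite (ginj j j0) ?ltnSn ?orbT// gj.
exists M => j; rewrite ltnS leq_eqVlt => /orP[/eqP gj|/MP//].
by case: Nj0; exists j.
Qed.

(** The maps [q] of the next sections present [B] as the product of the algebras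
    [C n] modulo the ideal of sequences that are eventually bottom. *)
Section reduced_product.
Context {d d' : Order.disp_t} {B : ctbDistrLatticeType d}.
Context {C : nat -> ctbDistrLatticeType d'}.
Variable q : (forall n, C n) -> B.
Hypothesis q_surj : forall b, exists x, q x = b.
Hypothesis q_meet :
  forall x y, q (fun n => Order.meet (x n) (y n)) = Order.meet (q x) (q y).
Hypothesis q_compl :
  forall x, q (fun n => Order.compl (x n)) = Order.compl (q x).
Hypothesis q_bot : forall x, q x = \bot%O <->
  exists N, forall n, (N <= n)%N -> x n = \bot%O.

Lemma reduced_le x y : (q x <= q y)%O <->
  exists N, forall n, (N <= n)%N -> (x n <= y n)%O.
Proof.
rewrite -[q y]complK -disj_leC -q_compl -q_meet.
split=> [/eqP/q_bot|] [N NP].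
  by exists N => n /NP /eqP; rewrite disj_leC complK.
apply/eqP/q_bot; exists N => n /NP.
by rewrite -[y n]complK -disj_leC complK => /eqP.
Qed.

Lemma reduced_eq x y :
  (exists N, forall n, (N <= n)%N -> x n = y n) -> q x = q y.
Proof.
move=> [N NP]; apply/le_anti/andP; split; apply/reduced_le; exists N => n /NP ->.
  exact: lexx.
exact: lexx.
Qed.

Section dominating.
Hypothesis C_nontrivial : forall n, \bot%O != \top%O :> C n.
Variables (K : eqType) (le : rel K).
Hypothesis le_omega1 : omega1_order le.
Hypothesis K_complete :
  forall A : set B, A #<= [set: K] -> aleph0_ideal_complete A.

(** The set of codes of the pairs in [P], as an element of [B]: a coding of pairs
    yields infinitely many disjoint infinite columns inside [nat]. *)
Let ind (P : set (nat * nat)) : B :=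
  q (fun n =>
    if pselect (exists2 p, P p & pickle p = n) then \top%O else \bot%O).

Let ind_bot P : ind P = \bot%O -> exists N, forall p, P p -> (pickle p < N)%N.
Proof.
move=> /q_bot[N NP]; exists N => p Pp; rewrite ltnNge; apply/negP => /NP.
case: pselect => [?|[]] /=; last by exists p.
by move=> /= /esym/eqP; rewrite (negbTE (C_nontrivial _)).
Qed.

Let ind_meet (P Q : set (nat * nat)) :
  Order.meet (ind P) (ind Q) = ind (P `&` Q).
Proof.
rewrite -q_meet; apply: reduced_eq; exists 0%N => n _.
case: (pselect (exists2 p, P p & _)) => [[p Pp pn]|NP] /=;
  case: (pselect (exists2 p, Q p & _)) => [[p' Qp p'n]|NQ] /=.
- rewrite meetxx; case: pselect => //= -[]; exists p => //; split=> //.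
  by rewrite (pcan_inj pickleK (etrans pn (esym p'n))).
- by rewrite meetx0; case: pselect => //= -[p' [_ Qp'] p'n]; case: NQ; exists p'.
- by rewrite meet0x; case: pselect => //= -[p [Pp _] pn]; case: NP; exists p.
- by rewrite meetx0; case: pselect => //= -[p [_ Qp] pn]; case: NQ; exists p.
Qed.

Let ind_le (P Q : set (nat * nat)) : P `<=` Q -> (ind P <= ind Q)%O.
Proof. by move=> /setIidl PQ; apply/meet_idPl; rewrite ind_meet PQ. Qed.

Let pickle_inj : injective (@pickle (nat * nat)%type : _ -> nat).
Proof. exact: (pcan_inj pickleK). Qed.

(** Completeness for no elements below and all columns [{m} * nat] on the other
    side gives [b] that meets each column in a bounded set, hence lies under the
    graph of some [f].  As the graph of [psi a] is not covered by finitely many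
    columns, it is not disjoint from [b], so [psi a] is at most [f] infinitely
    often. *)
Lemma not_dominating_of_complete (I : Type) (A : set I)
    (psi : I -> nat -> nat) :
  A #<= [set: K] ->
  exists f : nat -> nat, forall a, A a ->
    forall M, exists2 m, (M <= m)%N & (psi a m <= f m)%N.
Proof.
move=> AK.
pose column m := ind [set p | p.1 = m].
pose graph a := ind [set p | p.2 = psi a p.1].
pose A' : set B :=
  \bigcup_(b in [set: bool]) if b then graph @` A else range column.
have A'K : A' #<= [set: K].
  apply: (card_le_omega1_bigcup le_omega1) => // -[] _.
    exact: card_le_trans (card_image_le _ _) AK.
  apply: (card_le_omega1_countable le_omega1).
  exact: sub_countable (card_image_le _ _) (countableP _).
have join_below x : finite_join_of (set0 `|` range column) x ->
    exists M, (x <= ind [set p | (p.1 < M)%N])%O.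
  move=> [s + ->]; elim: s => [|y s IH] sP.
    by exists 0%N; rewrite big_nil le0x.
  have [|M1 M1P] := IH.
    by move=> z zs; apply: sP; rewrite in_cons zs orbT.
  have [[]|[m _ <-]] := sP y (mem_head _ _).
  exists (maxn M1 m.+1); rewrite big_cons leUx; apply/andP; split.
    by apply: ind_le => p /= ->; rewrite leq_max ltnSn orbT.
  by apply: le_trans M1P _; apply: ind_le => p /= pM; rewrite leq_max pM.
have fin_row (M : nat) (P : set (nat * nat)) :
    (forall m, (M <= m)%N -> exists j, P (m, j)) ->
    ~ (ind P <= ind [set p | (p.1 < M)%N])%O.
  move=> PM /meet_idPl indP.
  have : Order.meet (ind P) (ind [set p | (M <= p.1)%N]) = \bot%O.
    rewrite -indP -meetA ind_meet; apply/eqP; rewrite -lex0.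
    apply: (@le_trans _ _ (ind set0)).
      apply: (le_trans (leIr _ _)); apply: ind_le => p /= [].
      by rewrite ltnNge => /negP.
    rewrite lex0; apply/eqP/q_bot; exists 0%N => n _.
    by case: pselect => //= -[].
  rewrite ind_meet => /ind_bot[N NP].
  have /choice[j jP] : forall i, exists j, P ((M + i)%N, j).
    by move=> i; apply: PM; exact: leq_addr.
  have [|L LP] := @injective_nat_preimage_bounded
    (fun i => pickle ((M + i)%N, j i)) N.
    by move=> i1 i2 /pickle_inj[/addnI].
  have /LP : (pickle ((M + L)%N, j L) < N)%N.
    by apply: NP; split; [exact: jP | exact: leq_addr].
  by rewrite ltnn.
have colA' : range column `<=` A' by move=> x colx; exists false.
have colN1 : ~ finite_join_of (set0 `|` range column) \top%O.
  move=> /join_below[M M1]; apply: (@fin_row M setT); first by exists 0%N.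
  by apply: le_trans M1; exact: lex1.
have col_countable : countable (range column).
  exact: sub_countable (card_image_le _ _) (countableP _).
have [b [_ _ bcol _ bgraph]] := K_complete A'K (@sub0set _ A') colA'
  (countable0 B) col_countable (fun s t (s0 : set0 s) => False_ind _ s0) colN1.
have [x qx] := q_surj b; subst b.
have fex : forall m : nat, exists f : nat, forall j : nat,
    x (pickle (m, j)) != \bot%O -> (j <= f)%N.
  move=> m; have : Order.meet (column m) (q x) = \bot%O.
    by rewrite bcol//; exists m.
  rewrite -q_meet => /q_bot[N NP].
  have [|L LP] := @injective_nat_preimage_bounded (fun j => pickle (m, j)) N.
    by move=> i1 i2 /pickle_inj[].
  exists L => j xj; rewrite leqNgt; apply: contraNN xj => Lj.
  have Nj : (N <= pickle (m, j))%N.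
    by rewrite leqNgt; apply/negP => /LP; rewrite ltnNge (ltnW Lj).
  have := NP _ Nj; case: pselect => [?|[]] /=; last by exists (m, j).
  by rewrite meet1x => ->.
have [f fP] := choice fex.
exists f => a Aa M; apply: contrapT => NM.
have far m : (M <= m)%N -> x (pickle (m, psi a m)) = \bot%O.
  move=> Mm; apply/eqP/negPn/negP => /fP pf; apply: NM; by exists m.
have : Order.meet (graph a) (q x) = \bot%O.
  rewrite -q_meet; apply/q_bot.
  exists (\max_(m < M) (pickle (nat_of_ord m, psi a m)).+1) => n Mn.
  case: pselect => [[[m j] /= jm mn]|?] /=; last by rewrite meet0x.
  rewrite meet1x -mn jm far// leqNgt; apply/negP => mM.
  move: Mn; rewrite leqNgt => /negP; apply.
  by apply: leq_trans (leq_bigmax (Ordinal mM)); rewrite /= -mn jm.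
move=> /bgraph[|y [s sP ->] gle]; first by exists true => //; exists a.
have [|M' M'P] := join_below (\join_(y <- s) y)%O.
  by exists s => // z /sP colz; right.
apply: (@fin_row M' _ _ (le_trans gle M'P)) => m _.
by exists (psi a m).
Qed.

End dominating.
End reduced_product.

(** * The polar of a sequence without a supremum *)

Section no_cohen_parovicenko.
Context {d d' : Order.disp_t} {B : ctbDistrLatticeType d}.
Context {C : nat -> ctbDistrLatticeType d'}.
Variable q : (forall n, C n) -> B.
Hypothesis q_surj : forall b, exists x, q x = b.
Hypothesis q_meet :
  forall x y, q (fun n => Order.meet (x n) (y n)) = Order.meet (q x) (q y).
Hypothesis q_compl :
  forall x, q (fun n => Order.compl (x n)) = Order.compl (q x).
Hypothesis q_bot : forall x, q x = \bot%O <->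
  exists N, forall n, (N <= n)%N -> x n = \bot%O.
Variable c : forall n, nat -> C n.
Hypothesis c_gap : forall n (x : C n),
  (forall k, Order.meet x (c n k) = \bot%O) ->
  exists e : C n, [/\ e != \bot%O, Order.meet e x = \bot%O &
                      forall k, Order.meet e (c n k) = \bot%O].

Let q_le := reduced_le q_meet q_compl q_bot.
Let q_eq := reduced_eq q_meet q_compl q_bot.

Definition polar : set B :=
  [set b | exists2 x, q x = b & forall n k, Order.meet (x n) (c n k) = \bot%O].

(** Diagonalisation: [e n] is a nonzero element of the [n]-th algebra that is
    disjoint from all [c n k] and from the elements of [D] with code at most
    [n]. *)
Lemma polar_gap (D : set B) : countable D -> D `<=` polar ->
  exists2 e, polar e & forall b, D b -> ~ (e <= b)%O.
Proof.
move=> /countable_injP[code code_inj] Dpolar.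
have gex : forall i : nat, exists x : forall n, C n,
    (forall n k, Order.meet (x n) (c n k) = \bot%O) /\
    (forall b, D b -> code b = i -> q x = b).
  move=> i; have [[b Db bi]|Ni] := pselect (exists2 b, D b & code b = i).
    have [x xb xc] := Dpolar _ Db; exists x; split=> // b' Db' b'i.
    by rewrite xb; apply: code_inj; rewrite ?inE// bi.
  exists (fun n => \bot%O); split=> [n k|b Db bi]; first by rewrite meet0x.
  by case: Ni; exists b.
have [g gP] := choice gex.
pose y n := (\join_(i < n.+1) g i n)%O.
have eex : forall n, exists e : C n,
    [/\ e != \bot%O, Order.meet e (y n) = \bot%O &
    forall k, Order.meet e (c n k) = \bot%O].
  move=> n; apply: c_gap => k; apply/eqP; rewrite disj_leC /y.
  apply: joins_le => i _; rewrite -disj_leC; apply/eqP.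
  by have [gc _] := gP i; exact: gc.
pose e n := projT1 (cid (eex n)).
have eP n : [/\ e n != \bot%O, Order.meet (e n) (y n) = \bot%O &
    forall k, Order.meet (e n) (c n k) = \bot%O] by exact: projT2 (cid (eex n)).
exists (q e); first by exists e => // n k; have [] := eP n.
move=> b Db; have [_ /(_ _ Db erefl) <-] := gP (code b).
move=> /q_le[N NP]; pose n := maxn N (code b).
have [/negP + ey _] := eP n; apply; rewrite -ey; apply/eqP/esym/meet_idPl.
apply: le_trans (NP _ (leq_maxl _ _)) _.
have lt_n : (code b < n.+1)%N by rewrite ltnS leq_maxr.
exact: (joins_sup (j := Ordinal lt_n) (fun i : 'I_n.+1 => g i n)).
Qed.

Section omega1_sized.
Variables (K : eqType) (le : rel K).
Hypothesis le_omega1 : omega1_order le.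
Hypothesis K_complete :
  forall A : set B, A #<= [set: K] -> aleph0_ideal_complete A.

(** The separating element is the complement of the sequence of finite joins
    of [c n k] for [k <= f n].  Elements of [polar] are disjoint from these
    joins for every [f]; an element of [A] outside [polar] meets [c n k] for
    infinitely many [n], and an [f] not dominated by the associated indices
    catches [k <= f n] infinitely often. *)
Lemma polar_separation (A : set B) : A #<= [set: K] ->
  exists b, forall a, A a -> (polar a <-> (a <= b)%O).
Proof.
move=> AK.
have [r rP] := choice q_surj.
(* [psi (a, m)] bounds some coordinate [n >= m] and some index [k] at which [a]
   meets [c n k].  Passing to the next such [n] makes it a total function of
   [m], although [a] may meet the [c n k] on a sparse set of coordinates. *)
have psiex : forall p : B * nat, exists m : nat,
    (exists2 n, (p.2 <= n)%N &
      exists k, Order.meet (r p.1 n) (c n k) != \bot%O) ->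
    exists2 n, (p.2 <= n <= m)%N &
      exists2 k, (k <= m)%N & Order.meet (r p.1 n) (c n k) != \bot%O.
  move=> [a m].
  have [[n mn [k nk]]|] := pselect
    (exists2 n, (m <= n)%N & exists k, Order.meet (r a n) (c n k) != \bot%O).
    exists (maxn n k) => _; exists n; first by rewrite mn leq_maxl.
    by exists k => //; exact: leq_maxr.
  by move=> N; exists 0%N => /N.
have [psi psiP] := choice psiex.
have C_nontrivial n : \bot%O != \top%O :> C n.
  have [|e [e0 _ _]] := c_gap (n := n) (x := \bot%O).
    by move=> k; rewrite meet0x.
  by apply: contraNneq e0 => bt; rewrite -lex0 bt lex1.
have [f fP] := not_dominating_of_complete q_surj q_meet q_compl q_bot
  C_nontrivial le_omega1 K_complete (fun a m => psi (a, m)) AK.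
(* Monotonicity transfers [psi (a, m) <= f m] from [m] to the later coordinate
   [n] chosen by [psi]. *)
pose F n := \max_(m < n.+1) f m.
have fF m n : (m <= n)%N -> (f m <= F n)%N.
  move=> mn; have lt_mn : (m < n.+1)%N by [].
  exact: (leq_bigmax (F := fun i : 'I_n.+1 => f i) (Ordinal lt_mn)).
pose u n := (\join_(k < (F n).+1) c n k)%O.
exists (Order.compl (q u)) => a Aa; rewrite -disj_leC.
split=> [[x <- xc]|/eqP].
  rewrite -q_meet; apply/eqP/q_bot; exists 0%N => n _; apply/eqP.
  rewrite meetC disj_leC /u; apply: joins_le => k _.
  by rewrite -disj_leC meetC; apply/eqP; exact: xc.
rewrite -(rP a) -q_meet => /q_bot[N NP].
have {}NP n k : (N <= n)%N -> (k <= F n)%N ->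
    Order.meet (r a n) (c n k) = \bot%O.
  move=> Nn kn; apply/eqP; rewrite -lex0 -(NP _ Nn) leI2//.
  have lt_k : (k < (F n).+1)%N by [].
  exact: (joins_sup (j := Ordinal lt_k) (fun k : 'I_(F n).+1 => c n k)).
have [M MP] : exists M, forall n k, (M <= n)%N ->
    Order.meet (r a n) (c n k) = \bot%O.
  apply: contrapT => /forallNP NM.
  have [m Nm psim] := fP _ Aa N.
  have [|n /andP[mn nm] [k km /negP]] := psiP (a, m).
    have /existsNP[n /existsNP[k /not_implyP[mn /eqP nk]]] := NM m.
    by exists n => //; exists k.
  apply; apply/eqP/NP; first exact: leq_trans mn.
  by apply: (leq_trans km); apply: (leq_trans psim); exact: fF.
exists (fun n => if (M <= n)%N then r a n else \bot%O).
  by apply: q_eq; exists M => n ->.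
by move=> n k; case: ifP => [/MP//|_]; rewrite meet0x.
Qed.

Lemma polar_countably_cofinal (A : set B) : aleph0_ideal A -> A #<= [set: K] ->
  exists D, [/\ countable D, D `<=` A `&` polar &
    forall a, A a -> polar a -> exists2 b, D b & (a <= b)%O].
Proof.
move=> [_ Aideal] AK; have [b bP] := polar_separation AK.
have [Ab|NAb] := pselect (A b).
  exists [set b]; split; first exact: countable1.
    by move=> _ ->; split=> //; apply/bP.
  by move=> a Aa /(bP a Aa) ab; exists b.
have [D [cD Db Dcof]] := Aideal b NAb; exists D; split=> //.
  by move=> a /Db[Aa ab]; split=> //; apply/(bP a Aa)/ltW.
move=> a Aa /(bP a Aa) ab; apply: Dcof => //.
by rewrite lt_neqAle ab andbT; apply: contra_notN NAb => /eqP <-.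
Qed.

End omega1_sized.

(** Here [aleph_1] is regular, uncountable and smaller than [B]: the existence
    of a set witnessing [m_c(B)] bounds [B] below by the continuum. *)
Theorem reduced_product_not_cohen_parovicenko : ~ CH -> ~ cohen_parovicenko B.
Proof.
move=> NCH [B_star [[A0 _ A0c] B_mc]].
have [Y [Yunc YNc]] : exists Y : set (set nat),
    ~ countable Y /\ ~ (Y #= [set: set nat]).
  apply: contrapT => NY; apply: NCH => Y; apply: contrapT => NYc; apply: NY.
  by exists Y; split=> YP; apply: NYc; [left | right].
have [|K [le le_omega1]] := @exists_omega1 (set nat : choiceType).
  by move=> /(sub_countable (card_leT Y)).
have KY : [set: K] #<= Y := omega1_card_le le_omega1 Yunc.
have NcK : ~ ([set: set nat] #<= [set: K]).
  move=> /card_le_trans/(_ KY) cY; apply: YNc; apply/card_eqPle; split=> //.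
  exact: card_leT.
have KB : card_lt [set: K] [set: B].
  have cB : [set: set nat] #<= [set: B].
    move: A0c; rewrite card_eq_le => /andP[_ /card_le_trans]; apply.
    exact: card_leT.
  split; last by move=> /(card_le_trans cB).
  by apply: card_le_trans KY _; apply: card_le_trans (card_leT _) cB.
have K_complete (A : set B) : A #<= [set: K] -> aleph0_ideal_complete A.
  by move=> AK; apply: contrapT => /B_mc/card_le_trans/(_ AK).
have [F [F_ideal F_cofinal F_chain]] :=
  B_star K le (omega1_regular le_omega1) KB.
have FK (A : set B) : F A -> A #<= [set: K].
  by move=> /F_ideal[_]; rewrite card_eq_le => /andP[].
have [h _ h_inj] := card_leT_inj KB.1.
(* The family is only known to be cofinal for sets of size exactly [aleph_1],
   so smaller sets are padded with a copy [range h] of [K]. *)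
have F_cof (Z : set B) : exists A, Z #<= [set: K] -> F A /\ Z `<=` A.
  have [ZK|NZ] := pselect (Z #<= [set: K]); last by exists set0.
  pose S := \bigcup_(b in [set: bool]) if b then Z else range h.
  have [|A FA SA] := F_cofinal S.
    apply/card_eqPle; split.
      apply: (card_le_omega1_bigcup le_omega1) => // -[] _ //=.
      exact: card_le_trans (card_image_le _ _) (card_leT _).
    apply: card_le_trans (injective_card_le_range h_inj) _.
    by apply: subset_card_le => x hx; exists false.
  by exists A => _; split=> // x Zx; apply: SA; exists true.
have [G GP] := choice F_cof.
have gap (A : set B) : exists e, F A ->
    polar e /\ forall a, A a -> polar a -> ~ (e <= a)%O.
  have [FA|NFA] := pselect (F A); last by exists \bot%O.
  have [D [cD DA Dcof]] := polar_countably_cofinal le_omega1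
    K_complete (F_ideal _ FA).1 (FK _ FA).
  have [|e pe eP] := polar_gap cD; first by move=> a /DA[].
  exists e => _; split=> // a Aa /(Dcof a Aa)[b /eP + ab] ea; apply.
  exact: le_trans ab.
have [e eP] := choice gap.
have [le_wo seg_countable _] := le_omega1.
have lt_wf := well_order_lt_wf le_wo.
(* The chain: [A i] is a member of the family containing [A j] and [e (A j)]
   for all [j] before [i]. *)
pose step (i : K) (rec : forall j, le j i /\ j <> i -> set B) : set B :=
  G [set x | exists j (h : le j i /\ j <> i), rec j h x \/ x = e (rec j h)].
pose A := Fix lt_wf (fun _ => set B) step.
have AE i : A i =
    G (\bigcup_(j in [set j | le j i /\ j <> i]) (A j `|` [set e (A j)])).
  rewrite /A Fix_eq => [|k F1 F2 F12]; rewrite /step; congr G; apply/seteqP.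
    split => x /=.
      by move=> [j [ji [Ajx|Ajx]]]; exists j => //; [left|right].
    by move=> [j ji [Ajx|Ajx]]; exists j, ji; [left|right].
  split => x /= [j [ji Fx]]; exists j, ji; first by rewrite -F12.
  by rewrite F12.
have AP i : F (A i) /\ forall j, le j i -> j <> i ->
    A j `<=` A i /\ A i (e (A j)).
  elim/(well_founded_ind lt_wf): i => i IH.
  have [|] := GP (\bigcup_(j in [set j | le j i /\ j <> i])
    (A j `|` [set e (A j)])).
    apply: (card_le_omega1_bigcup le_omega1) => //.
      apply: sub_countable (seg_countable i); by apply: subset_card_le => j [].
    move=> j [ji jNi].
    apply: (@card_le_trans _ _ _
      (\bigcup_(b in [set: bool]) if b then A j else [set e (A j)])).
      by apply: subset_card_le => x [Ax|ex]; [exists true|exists false].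
    apply: (card_le_omega1_bigcup le_omega1) => // -[] _ /=; last first.
      exact/(card_le_omega1_countable le_omega1)/countable1.
    by apply: FK; have [] := IH j.
  rewrite -AE => FA subA; split=> // j ji jNi; split=> [x Ax|].
    by apply: subA; exists j => //; left.
  by apply: subA; exists j => //; right.
have A_mono i j : le i j -> A i `<=` A j.
  move=> ij; have [->//|/eqP iNj] := eqVneq i j.
  by have [_ /(_ i ij iNj)[]] := AP j.
have FU : F (\bigcup_(i in [set: K]) A i).
  apply: F_chain => //; first exact: (omega1_uncountable_cofinality le_omega1).
    by move=> i _; have [] := AP i.
  by move=> i j _ _; exact: A_mono.
have [D [cD DU Dcof]] := polar_countably_cofinal le_omega1
  K_complete (F_ideal _ FU).1 (FK _ FU).
have [i0 _] := omega1_countable_bounded le_omega1 (countable0 K).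
(* The stages at which the countably many elements of [D] appear are bounded. *)
have rank_ex x : exists i, D x -> A i x.
  have [/DU[[i _ Aix] _]|ND] := pselect (D x); first by exists i.
  by exists i0.
have [rank rankP] := choice rank_ex.
have [i iP] := omega1_countable_bounded le_omega1
  (sub_countable (card_image_le rank D) cD).
have [i' ii'] := omega1_countable_bounded le_omega1 (countable1 i).
have {ii'} [ii' iNi'] := ii' i erefl.
have [FAi _] := AP i; have [pe eA] := eP _ FAi.
have [|b Db eb] := Dcof (e (A i)) _ pe.
  by exists i' => //; have [_ /(_ i ii' iNi')[]] := AP i'.
have [_ pb] := DU b Db; apply: (eA b _ pb eb).
apply: (A_mono (rank b)); last exact: rankP.
by have [] := iP (rank b) (imageP _ Db).
Qed.

End no_cohen_parovicenko.

(** * Clopen sets in compact zero-dimensional spaces *)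

Lemma compact_directed_cover (T : topologicalType) (K : set T)
    (DD : set (set T)) :
  compact K -> DD !=set0 -> (forall D, DD D -> open D) ->
  (forall D1 D2, DD D1 -> DD D2 -> DD (D1 `|` D2)) ->
  (forall x, K x -> exists2 D, DD D & D x) ->
  exists2 D, DD D & K `<=` D.
Proof.
move=> /compact_near_coveringP cK [D0 DD0] DDopen DDU DDcov.
(* The sections of the directed family [DD] generate a filter, to which the
   near-covering form of compactness applies. *)
pose F := filter_from DD (fun D1 => [set D | DD D /\ D1 `<=` D]).
have FF : Filter F.
  apply: filter_from_filter; first by exists D0.
  move=> D1 D2 DD1 DD2; exists (D1 `|` D2); first exact: DDU.
  by move=> D [DD_D]; rewrite subUset => -[].
suff : F [set D | K `<=` D].
  by move=> [D DD_D FD]; exists D => //; apply: FD; split.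
apply: (cK _ F (fun D x => D x)).
move=> x /DDcov[D DD_D Dx].
exists (D, [set D' | DD D' /\ D `<=` D']); first split.
- by apply: open_nbhs_nbhs; split; [exact: DDopen | exact: Dx].
- by exists D.
by move=> [y D'] [/= Dy [_ DD']]; exact: DD'.
Qed.

Lemma compact_clopen_between (T : topologicalType) (K U : set T) :
  hausdorff_space T -> compact [set: T] -> zero_dimensional T ->
  compact K -> open U -> K `<=` U ->
  exists D, [/\ clopen D, K `<=` D & D `<=` U].
Proof.
move=> hT cT zT cK oU KU.
have [|D [cD DU]|D1 D2 [c1 s1] [c2 s2]|x Kx|D [cD DU] KD] :=
  compact_directed_cover (DD := [set D | clopen D /\ D `<=` U]) cK.
- by exists set0; split; [exact: clopen0 | exact: sub0set].
- by case: cD.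
- by split; [exact: clopenU | rewrite subUset].
- have /(_ U) [] := zero_dimensional_cvg (x := x) hT zT cT.
    by apply: open_nbhs_nbhs; split=> //; exact: KU.
  by move=> D [Dx cD] DU; exists D.
by exists D.
Qed.

Definition mk_clopens (T : topologicalType) (A : set T) (cA : clopen A) :
  clopens T := Clopens (asboolT cA).

Lemma clopens_clopen (T : topologicalType) (A : clopens T) : clopen (A : set T).
Proof. by case: A => A /= /asboolP. Qed.

(** Let [f] be continuous with cozero set [A] of non-clopen closure.  Clopen
    sets [c k] between [[|f| >= 1/(k+1)]] and [A] have union [A].  If [x] is a
    clopen set disjoint from all of them, then it is disjoint from
    [closure A], and is not its complement: there is room for a nonempty clopen
    set outside both. *)
Lemma not_basically_disconnected_gap (R : realType) (T : topologicalType) :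
  hausdorff_space T -> compact [set: T] -> zero_dimensional T ->
  ~ basically_disconnected R T ->
  exists c : nat -> clopens T, forall x : clopens T,
    (forall k, Order.meet x (c k) = \bot%O) ->
    exists e : clopens T, [/\ e != \bot%O, Order.meet e x = \bot%O &
      forall k, Order.meet e (c k) = \bot%O].
Proof.
move=> hT cT zT /existsNP[A /not_implyP[[f fcont ->] NclA]] {A}.
set A := [set x | _] in NclA.
have nfcont : continuous (fun x => `|f x|%R).
  by move=> x; apply: continuous_comp; [exact: fcont | exact: norm_continuous].
have oA : open A.
  rewrite (_ : A = (fun x => `|f x|%R) @^-1` [set r | (0 < r)%R]).
    by move/continuousP : nfcont; apply; exact: open_gt.
  by apply/seteqP; split => x; rewrite /A /= normr_gt0.
pose level k := [set x | (k.+1%:R^-1 <= `|f x|)%R].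
have /choice[c cP] k : exists c : clopens T,
    level k `<=` (c : set T) /\ (c : set T) `<=` A.
  have [||D [cD KD DA]] := @compact_clopen_between T (level k) A hT cT zT _ oA.
  - apply: (subclosed_compact _ cT) => //.
    move/continuous_closedP : nfcont => nfcl.
    by apply: (nfcl [set r | _ <= r]%R); exact: closed_ge.
  - move=> x /= kx; rewrite /A/= -normr_gt0; apply: lt_le_trans kx.
    by rewrite invr_gt0 ltr0n.
  by exists (mk_clopens cD).
have Ac x : A x -> exists k, (c k : set T) x.
  rewrite /A/= -normr_gt0 => /ltr_add_invr[k]; rewrite add0r => /ltW kx.
  by exists k; exact: (cP k).1.
exists c => x xc.
have xA : (x : set T) `&` A = set0.
  apply/seteqP; split=> // y [xy /Ac[k cky]].
  suff : (Order.meet x (c k) : set T) y by rewrite xc.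
  by split.
have xclA : closure A `<=` ~` (x : set T).
  have [ox _] := clopens_clopen x.
  move=> y clAy xy; have [|z [Az xz]] := clAy (x : set T).
    exact: open_nbhs_nbhs.
  by have : set0 z by rewrite -xA.
have [y [Nxy NAy]] : exists y, ~ (x : set T) y /\ ~ closure A y.
  apply: contrapT => Ny; apply: NclA.
  have -> : closure A = ~` (x : set T).
    apply/seteqP; split=> // y Nxy; apply: contrapT => NAy.
    by apply: Ny; exists y.
  exact/clopenC/clopens_clopen.
have [||D [cD yD DA]] := @compact_clopen_between T [set y]
  (~` (x : set T) `&` ~` closure A) hT cT zT (@compact_set1 T y).
- apply: openI; first by have /clopenC[] := clopens_clopen x.
  exact/closed_openC/closed_closure.
- by move=> _ ->.
exists (mk_clopens cD); split.
- by apply/eqP => /(congr1 val)/= D0; have := yD y erefl; rewrite D0.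
- apply: val_inj; apply/seteqP; split=> // z [/= Dz xz].
  by have [] := DA z Dz.
- move=> k; apply: val_inj; apply/seteqP; split=> // z [/= Dz cz].
  have [_] := DA z Dz; apply; apply: subset_closure; exact: (cP k).2.
Qed.

(** * Clopen algebra of the remainder of a sum *)

Lemma open_setD (T : topologicalType) (A V : set T) :
  open A -> closed V -> open (A `\` V).
Proof.
by move=> oA cV; rewrite setDE; apply: openI => //; exact: closed_openC.
Qed.

Lemma clopens_compl_val (T : topologicalType) (A : clopens T) :
  (Order.compl A : set T) = ~` (A : set T).
Proof. by []. Qed.

Section remainder_of_sum.
Variables (X : nat -> topologicalType) (bX : topologicalType).
Variable e : {n : nat & X n} -> bX.
Hypothesis X_compact : forall n, compact [set: X n].
Hypothesis e_stone_cech : is_stone_cech e.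

Let e_dense (O : set bX) : open O -> (forall p, ~ O (e p)) -> O = set0.
Proof.
move=> oO Oe; apply/eqP/negPn/negP => /set0P O0.
have [z [Oz [p _ pz]]] := stone_cech_dense e_stone_cech O0 oO.
by apply: (Oe p); rewrite pz.
Qed.

Let block n : set bX := range (fun y : X n => e (existT _ n y)).

Let block_compact n : compact (block n).
Proof.
apply: continuous_compact; last exact: X_compact.
apply: continuous_subspaceT => y.
apply: continuous_comp; first exact: existT_continuous.
exact: (stone_cech_continuous e_stone_cech).
Qed.

Let block_closed n : closed (block n).
Proof. exact: compact_closed (stone_cech_hausdorff e_stone_cech) _. Qed.

Let block_inv n p : block n (e p) -> projT1 p = n.
Proof.
by move=> [y _ /(stone_cech_injective e_stone_cech) <-].
Qed.

(** The embedding gives an open [V] whose trace on the sum is the [n]-th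
    summand; as the block is closed, density forces [V] to be the block
    itself. *)
Let block_open n : open (block n).
Proof.
have oXn : open (existT X n @` [set: X n]).
  by apply: existT_open_map; exact: openT.
have [V oV XnV] := stone_cech_embedding e_stone_cech oXn.
have VP p : V (e p) <-> projT1 p = n.
  split=> [Vp|].
    have : (e @^-1` V) p by [].
    by rewrite -XnV => -[y _ <-].
  case: p => m y /= mn; subst m.
  have : (existT X n @` [set: X n]) (existT _ n y) by exists y.
  by rewrite XnV.
have -> : block n = V; last by [].
apply/seteqP; split=> [_ [y _ <-]|z Vz]; first exact/VP.
apply: contrapT => Nz.
have /seteqP[/(_ z)] : V `\` block n = set0; last by move=> + _; apply.
apply: e_dense; first by apply: open_setD.
move=> [m y] [/VP /= mn]; subst m; apply; by exists y.
Qed.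

Let initial_blocks N : set bX := \bigcup_(n in `I_N) block n.

Let initial_blocks_clopen N : clopen (initial_blocks N).
Proof.
split; first by apply: bigcup_open => n _; exact: block_open.
by apply: closed_bigcup => [|n _]; [exact: finite_II | exact: block_closed].
Qed.

Let initial_blocksE N p : initial_blocks N (e p) <-> (projT1 p < N)%N.
Proof.
split=> [[n nN /block_inv ->]//|pN]; exists (projT1 p) => //.
by case: p {pN} => n y; exists y.
Qed.

Let range_open : open (range e).
Proof.
rewrite (_ : range e = \bigcup_n block n).
  by apply: bigcup_open => n _; exact: block_open.
apply/seteqP; split => [_ [[n y] _ <-]|_ [n _ [y _ <-]]].
  by exists n => //; exists y.
by exists (existT _ n y).
Qed.

(** The initial unions of blocks are an increasing open cover of the sum, and a
    closed subset of the compactification is compact. *)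
Lemma closed_in_sum_initial (K : set bX) : closed K -> K `<=` range e ->
  exists N, K `<=` initial_blocks N.
Proof.
move=> clK Ke.
have [| |D [N _ <-]|_ _ [N1 _ <-] [N2 _ <-]|z Kz|_ [N _ <-]] :=
  @compact_directed_cover bX K (range initial_blocks).
- exact: (subclosed_compact clK (stone_cech_compact e_stone_cech)).
- by exists (initial_blocks 0), 0%N.
- by have [] := initial_blocks_clopen N.
- exists (maxn N1 N2) => //; apply/seteqP; split=> z.
    by move=> [n /=]; rewrite leq_max => /orP[nN|nN] nz; [left|right]; exists n.
  by move=> [|] [n /= nN nz]; exists n => //=; rewrite leq_max nN ?orbT.
- have [p _ pz] := Ke z Kz; exists (initial_blocks (projT1 p).+1).
    by exists (projT1 p).+1.
  by rewrite -pz; apply/initial_blocksE.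
by exists N.
Qed.

(** The extension property is applied to the indicator function of [U], with
    values in the discrete two-point space. *)
Lemma clopen_extension (U : set {n : nat & X n}) : clopen U ->
  exists V : set bX, clopen V /\ forall p, V (e p) <-> U p.
Proof.
move=> [oU clU].
pose f p : bool := `[< U p >].
have fcont : continuous f.
  apply/continuousP => A _.
  rewrite (_ : f @^-1` A = (if pselect (A true) then U else set0) `|`
                           (if pselect (A false) then ~` U else set0)).
    apply: openU; case: pselect => _ //=; try exact: open0.
    exact: closed_openC.
  rewrite /f; apply/seteqP; split => p /=.
    by case: asboolP => Up Ap; [left|right]; case: pselect.
  move=> [|]; case: pselect => //= ?; first by move=> /asboolT ->.
  by move=> /asboolF ->.
have [g gcont gP] := stone_cech_extension e_stone_cech
  (@discrete_hausdorff bool) bool_compact fcont.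
exists (g @^-1` [set true]); split.
  split; first by move/continuousP : gcont; apply; exact: discrete_open.
  by move/continuous_closedP : gcont; apply; exact: discrete_closed.
by move=> p; rewrite /= gP /f; split=> [/asboolP|/asboolT].
Qed.

Lemma clopen_extension_unique (V W : set bX) : clopen V -> clopen W ->
  (forall p, V (e p) <-> W (e p)) -> V = W.
Proof.
move=> cV cW VW.
have sub (V' W' : set bX) : clopen V' -> clopen W' ->
    (forall p, V' (e p) -> W' (e p)) -> V' `<=` W'.
  move=> [oV' _] [_ clW'] VW' z Vz; apply: contrapT => NWz.
  have /seteqP[/(_ z)] : V' `\` W' = set0; last by move=> + _; apply.
  by apply: e_dense => [|p [/VW']//]; exact: open_setD.
by apply/seteqP; split; apply: sub => // p /VW.
Qed.

Let sum_set (x : forall n, clopens (X n)) : set {n : nat & X n} :=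
  [set p | (x (projT1 p) : set _) (projT2 p)].

Let sum_set_clopen x : clopen (sum_set x).
Proof.
split; first by apply/sigT_openP => n; have [] := clopens_clopen (x n).
rewrite -openC; apply/sigT_openP => n.
by have [_ clx] := clopens_clopen (x n); exact: closed_openC.
Qed.

Let extend x : set bX := projT1 (cid (clopen_extension (sum_set_clopen x))).

Let extend_clopen x : clopen (extend x).
Proof. by have [] := projT2 (cid (clopen_extension (sum_set_clopen x))). Qed.

Let extendE x n y : extend x (e (existT _ n y)) <-> (x n : set _) y.
Proof.
have [_] := projT2 (cid (clopen_extension (sum_set_clopen x))).
by move=> /(_ (existT _ n y)).
Qed.

Let trace_clopen x : clopen (set_val @^-1` extend x : set (remainder e)).
Proof.
exact: (preimage_clopen (extend_clopen x)
  (@initial_continuous (~` range e : Type) bX set_val)).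
Qed.

Definition trace (x : forall n, clopens (X n)) : clopens (remainder e) :=
  mk_clopens (trace_clopen x).

Lemma trace_meet x y :
  trace (fun n => Order.meet (x n) (y n)) = Order.meet (trace x) (trace y).
Proof.
apply: val_inj => /=; rewrite (_ : extend _ = extend x `&` extend y)//.
apply: clopen_extension_unique; first exact: extend_clopen.
  by apply: clopenI; exact: extend_clopen.
move=> [n z]; split=> [/extendE[xz yz]|[/extendE xz /extendE yz]].
  by split; apply/extendE.
by apply/extendE; split.
Qed.

Lemma trace_compl x :
  trace (fun n => Order.compl (x n)) = Order.compl (trace x).
Proof.
apply: val_inj => /=; rewrite (_ : extend _ = ~` extend x)//.
apply: clopen_extension_unique; first exact: extend_clopen.
  have [oV clV] := extend_clopen x.
  by split; [exact: closed_openC | exact: open_closedC].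
move=> [n z]; split=> [/extendE|Nxz].
  by rewrite clopens_compl_val => Nxz /extendE.
by apply/extendE; rewrite clopens_compl_val => xz; apply: Nxz; apply/extendE.
Qed.

(** If the extension of [x] misses the remainder, it is a compact subset of the
    sum and so meets finitely many blocks.  Conversely, an extension whose
    trace on the sum lies in finitely many blocks lies in these blocks, by
    density. *)
Lemma trace_bot x : trace x = \bot%O <->
  exists N, forall n, (N <= n)%N -> x n = \bot%O.
Proof.
split=> [tx0|[N NP]].
  have [|z xz|N NP] := @closed_in_sum_initial (extend x).
  - by have [] := extend_clopen x.
  - apply: contrapT => Nz.
    suff : (trace x : set (remainder e)) (exist _ z (mem_set Nz)).
      by rewrite tx0.
    by rewrite /= set_valE.
  exists N => n Nn; apply: val_inj; apply/seteqP; split=> // y xy.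
  have /NP/initial_blocksE/= : extend x (e (existT _ n y)) by apply/extendE.
  by rewrite ltnNge Nn.
apply: val_inj; apply/seteqP; split=> // -[z zP] /= xz.
have /set_mem Nz := zP.
have /seteqP[/(_ z)] : extend x `\` initial_blocks N = set0.
  apply: e_dense; first apply: open_setD.
  - by have [] := extend_clopen x.
  - by have [] := initial_blocks_clopen N.
  move=> [n y] [/extendE xy]; apply; apply/initial_blocksE => /=.
  by rewrite ltnNge; apply/negP => /NP xn0; rewrite xn0 in xy.
move=> + _; apply; split=> // -[n _ [y _ yz]].
by apply: Nz; exists (existT _ n y).
Qed.

(** [W] and its complement in the remainder are disjoint closed subsets [K1],
    [K2] of the compactification, so they have disjoint open neighbourhoods [U]
    and [V].  What [U] and [V] leave uncovered lies in the first [N] blocks;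
    in the later blocks the traces of [U] and [V] are complementary, hence
    clopen, and the trace of [U] there is a representative of [W]. *)
Lemma trace_surj (W : clopens (remainder e)) : exists x, trace x = W.
Proof.
have [oW clW] := clopens_clopen W.
have [O1 oO1 O1W] := oW; have [O2 oO2 O2W] := closed_openC clW.
have O1P (r : remainder e) : O1 (set_val r) <-> (W : set _) r by rewrite -O1W.
have O2P (r : remainder e) : O2 (set_val r) <-> ~ (W : set _) r.
  by have := congr1 (fun S : set (remainder e) => S r) O2W => /= ->.
have cl_rem : closed (~` range e) by exact: open_closedC range_open.
pose K1 := ~` range e `&` ~` O2; pose K2 := ~` range e `&` ~` O1.
have clK1 : closed K1 by apply: closedI => //; exact: open_closedC.
have clK2 : closed K2 by apply: closedI => //; exact: open_closedC.
have K12 : K1 `<=` ~` K2.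
  move=> z [Nz NO2] [_ NO1]; pose r : remainder e := exist _ z (mem_set Nz).
  have [Wr|NWr] := pselect ((W : set _) r); first by apply: NO1; exact/(O1P r).
  by apply: NO2; exact/(O2P r).
have nbhsK1 : set_nbhs K1 (~` K2).
  by apply/set_nbhsP; exists (~` K2); split=> //; exact: closed_openC.
have [D KD DK] := compact_normal (stone_cech_hausdorff e_stone_cech)
  (stone_cech_compact e_stone_cech) clK1 nbhsK1.
have [U [oU KU UD]] := (set_nbhsP _ _).1 KD.
pose V := ~` closure D.
have oV : open V by exact/closed_openC/closed_closure.
have UV z : U z -> ~ V z by move=> /UD Dz; apply; exact: subset_closure.
have KV : K2 `<=` V by move=> z K2z /DK.
have [||N NP] := @closed_in_sum_initial (~` (U `|` V)).
- by apply: open_closedC; exact: openU.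
- move=> z NUV; apply: contrapT => Nz; apply: NUV.
  have [O2z|NO2z] := pselect (O2 z); last by left; exact: KU.
  right; apply: KV; split=> // O1z.
  pose r : remainder e := exist _ z (mem_set Nz).
  by have /(O2P r) : O2 (set_val r) by []; apply; exact/(O1P r).
have xex n : exists x : clopens (X n),
    forall y, (x : set _) y <-> (N <= n)%N /\ U (e (existT _ n y)).
  have [Nn|nN] := leqP N n; last first.
    by exists \bot%O => y; split=> [|[]].
  have econt : continuous (fun y : X n => e (existT _ n y)).
    move=> y; apply: continuous_comp; first exact: existT_continuous.
    exact: (stone_cech_continuous e_stone_cech).
  have cS : clopen [set y : X n | U (e (existT _ n y))].
    split; first by move/continuousP : econt; exact.
    rewrite -openC (_ : ~` _ = [set y | V (e (existT _ n y))]).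
      by move/continuousP : econt; exact.
    apply/seteqP; split=> y /= => [NUy|Vy Uy]; last exact: UV Vy.
    apply: contrapT => NVy.
    have /NP/initial_blocksE/= : (~` (U `|` V)) (e (existT _ n y)) by case.
    by rewrite ltnNge Nn.
  by exists (mk_clopens cS) => y; split=> [|[]].
pose x n := projT1 (cid (xex n)).
have xP n y : (x n : set _) y <-> (N <= n)%N /\ U (e (existT _ n y)).
  exact: (projT2 (cid (xex n)) y).
exists x; apply: val_inj; apply/seteqP; split=> -[z zP] /=.
  move=> xz; apply: contrapT => NWz; have /set_mem Nz := zP.
  have Vz : V z.
    by apply: KV; split=> // O1z; apply: NWz; exact/(O1P (exist _ z zP)).
  have /seteqP[/(_ z)] : V `&` extend x = set0; last by move=> + _; apply.
  apply: e_dense; first by apply: openI => //; have [] := extend_clopen x.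
  by move=> [n y] [Vy /extendE/xP[_ Uy]]; exact: UV Vy.
move=> Wz; have /set_mem Nz := zP.
have Uz : U z.
  by apply: KU; split=> // /(O2P (exist _ z zP)); apply.
apply: contrapT => Nxz.
have /seteqP[/(_ z)] : U `\` extend x `\` initial_blocks N = set0.
  apply: e_dense => [|[n y] [[Uy Nxy] Ny]].
    apply: open_setD; last by have [] := initial_blocks_clopen N.
    by apply: open_setD => //; have [] := extend_clopen x.
  apply: Nxy; apply/extendE/xP; split=> //; rewrite leqNgt; apply/negP => nN.
  by apply: Ny; apply/initial_blocksE.
move=> + _; apply; split=> // -[n _ [y _ yz]].
by apply: Nz; exists (existT _ n y).
Qed.

End remainder_of_sum.

Theorem theorem6p3 (R : realType) (X : nat -> topologicalType)
    (bX : topologicalType) (e : {n : nat & X n} -> bX) :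
  ~ CH ->
  (forall n, [/\ hausdorff_space (X n), compact [set: X n],
                 zero_dimensional (X n) & ~ basically_disconnected R (X n)]) ->
  is_stone_cech e ->
  ~ cohen_parovicenko_space (remainder e).
Proof.
move=> NCH XP e_sc.
have X_compact n : compact [set: X n] by have [] := XP n.
have cex n := let: And4 hX cX zX nX := XP n in
  not_basically_disconnected_gap hX cX zX nX.
pose c n := projT1 (cid (cex n)).
apply: (reduced_product_not_cohen_parovicenko (C := fun n => clopens (X n))
  (trace_surj X_compact e_sc) (trace_meet e_sc)
  (trace_compl e_sc) (trace_bot X_compact e_sc) (c := c) _ NCH).
by move=> n; exact: projT2 (cid (cex n)).
Qed.
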